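(* For all integers $k\ge 1$ and $s\ge 1$, $$|E'''_{k,k,s}|=\sum_{t=1}^{s-k+1}2\,|E'_{k,k-1,s-t}|\binom{k}{t},$$ where $E'_{m,r,e}$ is the set of connected bipartite colorless graphs on $[m]$ of rank $r$ and cardinality $e\ge 1$, and $E'''_{m,r,e}$ is the set of connected central $3$-colored graphs of the third kind on $[m]$ of rank $r$ and cardinality $e$.
   Context: Graphs are finite, simple and labeled, with vertex set $[m]=\{1,\dots,m\}$. A $3$-colored graph is a graph $G=(V,E)$ together with a color function $\gamma:V\to\{1,-1,0\}$; a vertex $v$ is colorless if $\gamma(v)=0$ and colored if $\gamma(v)\in\{1,-1\}$. A graph is colorless if all its vertices are. Rank: with $V=\{1,\dots,m\}$ and $\mathbf e_j$ the $j$th standard row vector of $\mathbb R^m$, the c-incidence matrix $J_G$ is the real $(|E|+m)\times m$ matrix whose first $|E|$ rows are $\mathbf e_i+\mathbf e_j$, one for each edge $\{i,j\}$, and whose last $m$ rows are $\gamma(i)\mathbf e_i$. The rank of $G$ is the rank of $J_G$ over $\mathbb R$. Cardinality: the number of edges plus the number of colored vertices. The sets $E'_{m,r,e}$ are only populated for $e\ge 1$: by convention $E'_{m,r,e}=\emptyset$ for $e\le 0$. Third kind: a $3$-colored graph is of the third kind if each of its connected components has at least one colored vertex and at least one edge. Central: $G$ is central if (1) whenever a vertex $v$ is colored, it is not on an odd cycle, and (2) $\gamma(v)=\gamma(v')$ (resp. $\gamma(v)\ne\gamma(v')$) for any pair of colored vertices $v,v'$ such that there is a $v$–$v'$ path of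 even (resp. odd) length. A sum over an empty range is $0$.
   Formalization: In the definition of central, paths and cycles are read as walks and closed walks (repeats allowed); with simple cycles the identity fails, e.g. for k=4, s=5 because of a triangle with one colored pendant vertex. *)

(* Defs.v *)
From HB Require Import structures.
From mathcomp Require Import all_boot all_order all_algebra.
From mathcomp Require Import boolp reals.

Set Implicit Arguments.
Unset Strict Implicit.
Unset Printing Implicit Defensive.

Import GRing.Theory.

Definition color := seq_sub [:: 1%R; (- 1)%R; 0%R : int].

Definition color_val (c : color) : int := ssval c.

(* The vertex set [m] = {1, ..., m} is rendered as 'I_m = {0, ..., m - 1}.    *)
Record cgraph (m : nat) := CGraph {
  cgraph_data : {set {set 'I_m}} * {ffun 'I_m -> color};
  cgraph_simple : [forall e in cgraph_data.1, #|e| == 2]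
}.

HB.instance Definition _ m := [isSub for @cgraph_data m].
HB.instance Definition _ m := [Finite of cgraph m by <:].

Section ColoredGraphs.
Variables (m : nat) (G : cgraph m).

Definition edges : {set {set 'I_m}} := (cgraph_data G).1.

Definition gamma (v : 'I_m) : int := color_val ((cgraph_data G).2 v).

Definition colored (v : 'I_m) : bool := gamma v != 0%R.

Definition colorless : bool := [forall v, ~~ colored v].

Definition adj : rel 'I_m := fun u v => [set u; v] \in edges.

Definition connected : bool := [forall u, forall v, connect adj u v].

Definition components : {set {set 'I_m}} :=
  equivalence_partition (connect adj) [set: 'I_m].

Definition bipartite : bool :=
  [exists A : {set 'I_m},
    forall u, forall v, adj u v ==> ((u \in A) != (v \in A))].

Definition c_incidence (R : realType) : 'M[R]_(#|edges| + m, m) :=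
  col_mx (\matrix_(a < #|edges|)
            \sum_(i in (enum_val a : {set 'I_m})) delta_mx 0%R i)%R
         (\matrix_(i < m) ((gamma i)%:~R *: delta_mx 0%R i))%R.

Definition rank (R : realType) : nat := \rank (c_incidence R).

Definition cardinality : nat := #|edges| + #|[set v | colored v]|.

Definition third_kind : bool :=
  [forall C in components,
    [exists v in C, colored v] && [exists e in edges, e \subset C]].

(* Paths and cycles may repeat vertices and edges (walks and closed walks), as *)
(* is the case for [path] and [cycle] of MathComp; the length of a path v :: p *)
(* is [size p] and that of a cycle c is [size c].  This makes G central iff    *)
(* the system x_i + x_j = 0 ({i, j} an edge), x_v = gamma v (v colored) is     *)
(* solvable.  With vertex-simple cycles and paths this would fail: a triangle  *)
(* with a pendant colored vertex would be central.                             *)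
Definition central : Prop :=
  (forall v, colored v ->
     ~ exists c, [/\ cycle adj c, v \in c & odd (size c)]) /\
  (forall v v' p, colored v -> colored v' ->
     path adj v p -> last v p = v' ->
     (~~ odd (size p) -> gamma v = gamma v') /\
     (odd (size p) -> gamma v <> gamma v')).

End ColoredGraphs.

Definition E' (R : realType) (m r e : nat) : {set cgraph m} :=
  [set G : cgraph m |
    [&& 1 <= e, connected G, bipartite G, colorless G,
        rank G R == r & cardinality G == e]].

Definition E''' (R : realType) (m r e : nat) : {set cgraph m} :=
  [set G : cgraph m |
    [&& connected G, `[< central G >], third_kind G,
        rank G R == r & cardinality G == e]].

(* Main.v *)
(** In a connected graph, a closed walk extends to one of the same parity through
    any given vertex, so a connected central graph with a
    colored vertex is bipartite; comparing walk parities then shows that, on a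
    bipartition A, its coloring is v |-> eps (-1)^[v in A] on the set T of colored
    vertices, for a global sign eps.  Hence a graph of E''' is the same thing as
    a graph H of E' together with a nonempty T and a sign.  The ranks are
    automatic: the right kernel of the incidence matrix of a connected
    bipartite graph consists of multiples of the sign vector of the bipartition,
    and vanishes as soon as one vertex is colored.  In particular H has at least
    k - 1 edges, which bounds the range of t = |T|. *)

Require Import Defs.
From mathcomp Require Import all_boot all_order all_algebra.
From mathcomp Require Import boolp reals.

Set Implicit Arguments.
Unset Strict Implicit.
Unset Printing Implicit Defensive.

Import GRing.Theory Num.Theory.

(** * Colors, recolorings and bipartitions *)

Definition color0 : color :=
  SeqSub (isT : (0%R : int) \in [:: 1%R; (- 1)%R; 0%R : int]).

(** With [true] standing for -1, [addb] on booleans is multiplication of signs. *)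
Definition sign_color (b : bool) : color :=
  if b then SeqSub (isT : (- 1)%R \in [:: 1%R; (- 1)%R; 0%R : int])
  else SeqSub (isT : 1%R \in [:: 1%R; (- 1)%R; 0%R : int]).

Lemma color_val_neq0 (c : color) :
  color_val c != 0%R -> exists b, c = sign_color b.
Proof.
case: c => x; rewrite /color_val /=; move=> xs x0.
have := xs; rewrite !inE (negPf x0) orbF => /orP[]/eqP xE.
- by exists false; apply: val_inj.
- by exists true; apply: val_inj.
Qed.

Lemma sign_color_inj : injective sign_color.
Proof. by case=> [] []. Qed.

Section Graphs.
Variable m : nat.
Implicit Types (G : cgraph m) (A T : {set 'I_m}).

Definition recolor G (c : {ffun 'I_m -> color}) : cgraph m :=
  @CGraph m (edges G, c) (cgraph_simple G).

Definition decolor G : cgraph m := recolor G [ffun=> color0].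

Definition signed_coloring A T (b : bool) : {ffun 'I_m -> color} :=
  [ffun v => if v \in T then sign_color (b (+) (v \in A)) else color0].

Definition bipartition G A : bool :=
  [forall u, forall v, adj G u v ==> ((u \in A) != (v \in A))].

(** Passing from a bipartition to its complement flips the global sign of a coloring. Fixing one
    choice per graph makes that sign a well-defined boolean. *)
Definition some_bipartition G : {set 'I_m} :=
  odflt set0 [pick A | bipartition G A].

Lemma some_bipartitionP G : bipartite G -> bipartition G (some_bipartition G).
Proof.
move=> /existsP[A GA]; rewrite /some_bipartition; case: pickP => //= noA.
by have := noA A; rewrite /bipartition GA.
Qed.

Lemma bipartition_adj G A u v :
  bipartition G A -> adj G u v -> (v \in A) = ~~ (u \in A).
Proof.
move=> /forallP/(_ u)/forallP/(_ v)/implyP GA /GA.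
by case: (u \in A); case: (v \in A).
Qed.

Lemma adj_sym G : symmetric (adj G).
Proof. by move=> u v; rewrite /adj setUC. Qed.

Lemma adj_neq G u v : adj G u v -> u != v.
Proof.
move=> uv; have /forallP/(_ [set u; v])/implyP/(_ uv) := cgraph_simple G.
by rewrite cards2; case: (u != v).
Qed.

Lemma bipartition_path G A u p : bipartition G A -> path (adj G) u p ->
  (last u p \in A) = (u \in A) (+) odd (size p).
Proof.
move=> GA; elim: p u => [|v p IHp] u /=; first by rewrite addbF.
by case/andP=> uv /IHp ->; rewrite (bipartition_adj GA uv) addNb addbN.
Qed.

Lemma connected_path G u v :
  connected G -> exists2 p, path (adj G) u p & last u p = v.
Proof.
by move=> /forallP/(_ u)/forallP/(_ v)/connectP[p up ->]; exists p.
Qed.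

Lemma colored_signed G A T b v :
  colored (recolor G (signed_coloring A T b)) v = (v \in T).
Proof. by rewrite /colored /gamma /= ffunE; case: ifP => //; case: addb. Qed.

Lemma colorless_data G : colorless G -> (cgraph_data G).2 = [ffun=> color0].
Proof.
move=> /forallP G0; apply/ffunP => v; rewrite ffunE; apply: val_inj => /=.
by have := G0 v; rewrite /colored negbK => /eqP.
Qed.

Lemma colorless_decolor G : colorless (decolor G).
Proof. by apply/forallP => v; rewrite /colored /gamma ffunE. Qed.

Lemma cgraph_ext G1 G2 :
  edges G1 = edges G2 -> (cgraph_data G1).2 = (cgraph_data G2).2 -> G1 = G2.
Proof.
move=> eE cE; apply: val_inj => /=.
by rewrite [LHS]surjective_pairing [RHS]surjective_pairing -/(edges G1) eE cE.
Qed.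

(** * Central graphs and sign colorings *)

Lemma signed_central G A T b :
  bipartition G A -> central (recolor G (signed_coloring A T b)).
Proof.
move=> GA; split=> [v _ [c [cyc vc odc]]|v v' p].
  case: c cyc vc odc => //= w c cyc _ odc.
  (* A cycle [w :: c] unfolds to the walk [rcons c w] from [w] back to [w]; odd length would put [w]
     on both sides of [A]. *)
  have := bipartition_path GA cyc; rewrite last_rcons size_rcons /= odc.
  by case: (w \in A).
rewrite !colored_signed => vT v'T pp lp.
have := bipartition_path GA pp; rewrite lp => v'A.
rewrite /gamma /= !ffunE vT v'T v'A.
by case: (odd _); case: (v \in A); case: {pp} b.
Qed.

Lemma rev_walk G u p : path (adj G) u p ->
  exists q, [/\ path (adj G) (last u p) q, last (last u p) q = u
            & size q = size p].
Proof.
move=> up; exists (rev (belast u p)); split.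
- by rewrite rev_path (eq_path (e' := adj G)) // => x y; rewrite adj_sym.
- case: p {up} => //= x p; by rewrite rev_cons last_rcons.
- by rewrite size_rev size_belast.
Qed.

Lemma central_no_odd_walk G v p : central G -> colored G v ->
  path (adj G) v p -> last v p = v -> ~~ odd (size p).
Proof.
move=> [G1 _] cv; case/lastP: p => [//|p w]; rewrite last_rcons => /[swap] -> vp.
apply/negP => od; apply: (G1 v cv); exists (v :: p).
by split; rewrite /= ?mem_head //; rewrite size_rcons in od.
Qed.

(** Following one walk from [v] to [u] and then the reverse of another gives a closed walk at the
    colored vertex [v], which is even. So the parity of a walk from [v] depends only on its end, and
    the vertices reached by odd walks form one side. *)
Lemma central_bipartite G v :
  connected G -> central G -> colored G v -> bipartite G.
Proof.
move=> Gc Gz cv.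
have par u p q : path (adj G) v p -> last v p = u ->
    path (adj G) v q -> last v q = u -> odd (size p) = odd (size q).
  move=> vp pu vq qu; have [q' []] := rev_walk vq.
  rewrite qu => uq' q'v sq.
  have := @central_no_odd_walk G v (p ++ q') Gz cv.
  rewrite cat_path vp pu uq' last_cat pu q'v size_cat oddD sq => /(_ isT erefl).
  by case: (odd (size p)); case: (odd (size q)).
pose walk u (p : seq 'I_m) := path (adj G) v p /\ last v p = u.
apply/existsP; exists [set u | `[< exists2 p, walk u p & odd (size p) >]].
apply/forallP => x; apply/forallP => y; apply/implyP => xy.
have [p vp px] := connected_path v x Gc.
have inA u q : walk u q ->
    (u \in [set u | `[< exists2 p, walk u p & odd (size p) >]]) = odd (size q).
  move=> [vq qu]; rewrite inE; apply/asboolP/idP => [[q' [vq' q'u]]|od].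
    by rewrite (par u q' q).
  by exists q.
have xp : walk x p by [].
have yp : walk y (rcons p y) by split; rewrite ?last_rcons // rcons_path vp px.
by rewrite (inA _ _ xp) (inA _ _ yp) size_rcons /=; case: (odd _).
Qed.

Lemma central_signed G A v : connected G -> central G -> bipartition G A ->
  colored G v ->
  exists b, (cgraph_data G).2 = signed_coloring A [set v | colored G v] b.
Proof.
move=> Gc [_ Gz] GA cv; have [b vb] := color_val_neq0 cv.
(* This sign is forced by the vertex [v]: adding [v \in A] once more must return its color [b]. *)
exists (b (+) (v \in A)); apply/ffunP => w; rewrite ffunE inE.
case: ifPn => [cw|]; last first.
  by rewrite negbK => /eqP w0; apply: val_inj.
have [b' wb'] := color_val_neq0 cw.
rewrite wb'; congr sign_color.
have [p vp pw] := connected_path v w Gc.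
have := bipartition_path GA vp; rewrite pw => ->.
have [] := Gz v w p cv cw vp pw; rewrite /gamma vb wb'.
case: (odd _) => /= [_ /(_ isT)|/(_ isT) + _]; case: (v \in A);
  by case: b {vb}; case: b' {wb'}.
Qed.

(** * The third kind for connected graphs *)

Lemma connected_component G C : connected G -> C \in components G -> C = setT.
Proof.
move=> /forallP Gc /imsetP[x _ ->]; apply/setP => y.
by rewrite !inE; have /forallP-> := Gc x.
Qed.

(** The whole vertex set is the only component. The vertex [v] makes it exist: on no vertices the
    left side would hold vacuously. *)
Lemma connected_third_kind G (v : 'I_m) : connected G ->
  third_kind G =
    [exists v, colored G v] && (edges G != set0).
Proof.
move=> Gc; apply/idP/andP.
  move=> /forallP/(_ setT)/implyP H.
  have /H /andP[/existsP[w /andP[_ cw]] /existsP[e /andP[eE _]]] :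
      setT \in components G.
    apply/imsetP; exists v => //; apply/setP => y.
    by rewrite !inE; have /forallP/(_ v)/forallP-> := Gc.
  by split; [apply/existsP; exists w | apply/set0Pn; exists e].
move=> [/existsP[w cw] /set0Pn[e eE]].
apply/forallP => C; apply/implyP => /(connected_component Gc) ->.
apply/andP; split; first by apply/existsP; exists w; rewrite inE.
by apply/existsP; exists e; rewrite eE subsetT.
Qed.

(** * Ranks via the kernel of the c-incidence matrix *)

Section Rank.
Variable R : realType.
Local Open Scope ring_scope.

Definition sign_vector A : 'rV[R]_m := \row_i (-1) ^+ (i \in A).

(** The right kernel is written as the left kernel of the transpose, the form that [kermx] handles.
    An edge row pairs with [u] to the sum of two entries, a color row to [gamma i] times one
    entry. *)
Lemma kernel_c_incidenceP G (u : 'rV[R]_m) :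
  reflect ((forall i j, adj G i j -> u 0 i + u 0 j = 0) /\
           (forall i, colored G i -> u 0 i = 0))
          (u *m (c_incidence G R)^T == 0).
Proof.
rewrite /c_incidence tr_col_mx mul_mx_row.
have rowE n (f : 'I_n -> 'rV[R]_m) a :
    (u *m (\matrix_(a < n) f a)^T) 0 a = \sum_k u 0 k * f a 0 k.
  by rewrite mxE; apply: eq_bigr => k _; rewrite !mxE.
have deltaE i : \sum_k u 0 k * (delta_mx 0 i : 'rV[R]_m) 0 k = u 0 i.
  rewrite (bigD1 i) //= mxE !eqxx mulr1 big1 ?addr0 // => k ki.
  by rewrite mxE (negPf ki) andbF mulr0.
have edgeE (e : {set 'I_m}) :
    \sum_k u 0 k * (\sum_(i in e) (delta_mx 0 i : 'rV[R]_m)) 0 k =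
    \sum_(i in e) u 0 i.
  under eq_bigr do rewrite summxE mulr_sumr.
  by rewrite exchange_big /=; apply: eq_bigr => i _.
apply: (iffP eqP) => [|[uE uC]].
  move=> u0; have [/rowP uE /rowP uC] :=
    eq_row_mx (etrans u0 (esym (row_mx0 _ _ _ _))).
  split=> [i j ij|i ci].
    have := uE (enum_rank_in (ij : [set i; j] \in edges G) [set i; j]).
    by rewrite rowE edgeE enum_rankK_in // mxE big_setU1 ?inE ?(adj_neq ij) //=
      big_set1.
  have := uC i; rewrite rowE mxE.
  under eq_bigr do rewrite mxE mulrCA.
  rewrite -mulr_sumr deltaE => /eqP; rewrite mulf_eq0 intr_eq0.
  by rewrite (negPf (ci : gamma G i != 0)) => /eqP.
apply: etrans (row_mx0 _ _ _ _); congr row_mx; apply/rowP => a; rewrite rowE mxE.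
  rewrite edgeE; have eE := enum_valP a.
  have /forallP/(_ (enum_val a))/implyP/(_ eE)/cards2P[i [j [ij eij]]] :=
    cgraph_simple G.
  rewrite eij big_setU1 ?inE //= big_set1; apply: uE.
  by rewrite /adj -eij.
under eq_bigr do rewrite mxE mulrCA.
rewrite -mulr_sumr deltaE.
have [/eqP->|/uC->] := boolP (gamma G a == 0); first by rewrite mul0r.
by rewrite mulr0.
Qed.

(** Crossing an edge negates both the entry of [u] and the sign given by [A], so their product is
    constant along walks. *)
Lemma kernel_connected G A (u : 'rV[R]_m) (v : 'I_m) :
  connected G -> bipartition G A ->
  (forall i j, adj G i j -> u 0 i + u 0 j = 0) ->
  u = (u 0 v * (-1) ^+ (v \in A)) *: sign_vector A.
Proof.
move=> Gc GA uE; apply/rowP => w; rewrite !mxE.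
have [p vp pw] := connected_path v w Gc.
elim: p v vp pw => [|x p IHp] v /= => [_ ->|/andP[vx xp] /(IHp _ xp) ->].
  by rewrite -mulrA -signr_addb addbb mulr1.
rewrite (bipartition_adj GA vx); congr (_ * _).
have /eqP := uE _ _ vx; rewrite addrC addr_eq0 => /eqP ->.
by rewrite mulNr -mulrN; congr (_ * _); case: (v \in A);
  rewrite /= ?expr0 ?expr1 ?opprK.
Qed.

Lemma sign_vector_neq0 A (v : 'I_m) : sign_vector A != 0.
Proof.
apply/eqP => /rowP/(_ v); rewrite !mxE => /eqP.
by rewrite signr_eq0.
Qed.

(** The kernel vectors are multiples of the sign vector, and the row of [v] forces the multiple to
    be zero. *)
Lemma rank_colored G A v : connected G -> bipartition G A -> colored G v ->
  rank G R = m.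
Proof.
move=> Gc GA cv; rewrite /rank -mxrank_tr; apply/eqP.
rewrite -/(row_free _) -kermx_eq0; apply/eqP/row_matrixP => i; rewrite row0.
have /kernel_c_incidenceP[uE uC] :
    row i (kermx (c_incidence G R)^T) *m (c_incidence G R)^T == 0.
  by rewrite -row_mul mulmx_ker row0.
by rewrite (kernel_connected v Gc GA uE) (uC _ cv) mul0r scale0r.
Qed.

Lemma rank_colorless G A (v : 'I_m) :
  connected G -> bipartition G A -> colorless G -> rank G R = (m - 1)%N.
Proof.
move=> Gc GA G0; rewrite /rank -mxrank_tr.
have kE : (kermx (c_incidence G R)^T :=: sign_vector A)%MS.
  apply/eqmxP/andP; split.
    apply/row_subP => i.
    have /kernel_c_incidenceP[uE _] :
        row i (kermx (c_incidence G R)^T) *m (c_incidence G R)^T == 0.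
      by rewrite -row_mul mulmx_ker row0.
    by rewrite (kernel_connected v Gc GA uE) scalemx_sub.
  apply/sub_kermxP/eqP/kernel_c_incidenceP; split=> [i j ij|i].
    rewrite !mxE (bipartition_adj GA ij).
    by case: (i \in A); rewrite /= ?expr0 ?expr1 ?subrr ?addNr.
  by have /forallP/(_ i)/negPf-> := G0.
have := mxrank_ker (c_incidence G R)^T; rewrite kE rank_rV.
rewrite (sign_vector_neq0 A v) => /= ->.
(* The kernel dimension [m] minus the rank has just replaced 1 in the goal; the truncated
   subtraction cancels because the rank is at most [m]. *)
by rewrite subKn // rank_leq_row.
Qed.

Lemma rank_le_edges G : colorless G -> (rank G R <= #|edges G|)%N.
Proof.
move=> G0; rewrite /rank /c_incidence.
set B := (X in col_mx X _); set C := (X in col_mx _ X).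
have -> : C = 0.
  apply/row_matrixP => i; rewrite rowK row0.
  have /forallP/(_ i) := G0; rewrite /colored negbK => /eqP ->.
  by rewrite scale0r.
by rewrite -addsmxE addsmx0 rank_leq_row.
Qed.

End Rank.

Lemma cardinality_colorless G : colorless G -> cardinality G = #|edges G|.
Proof.
move=> /forallP G0; rewrite /cardinality (_ : [set v | colored G v] = set0).
  by rewrite cards0 addn0.
by apply/setP => v; rewrite !inE (negPf (G0 v)).
Qed.

End Graphs.

(** * The bijection and the count *)

Section Counting.
Variables (R : realType) (m s : nat).
Implicit Types (G : cgraph m) (x : cgraph m * {set 'I_m} * bool).

Lemma in_E' (v : 'I_m) e G : (G \in E' R m (m - 1) e) =
  [&& 1 <= e, connected G, bipartite G, colorless G & #|edges G| == e].
Proof.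
rewrite inE; do 4 apply: andb_id2l => ?.
rewrite cardinality_colorless // (@rank_colorless _ R _ (some_bipartition G)) //.
  by rewrite eqxx.
exact: some_bipartitionP.
Qed.

(** Without colors only the edge rows can be nonzero, so the rank [m - 1] is at most the number of
    edges. This cuts off the sum over [t]. *)
Lemma E'_eq0 (v : 'I_m) e : e < m - 1 -> E' R m (m - 1) e = set0.
Proof.
move=> em; apply/setP => G; rewrite !inE; apply/negbTE/negP.
case/and5P=> _ _ _ G0 /andP[/eqP rG /eqP]; rewrite cardinality_colorless // => cG.
by have := rank_le_edges R G0; rewrite rG cG leqNgt em.
Qed.

(** The condition [edges x.1.1 != set0] serves twice: as the edge required by the third kind, and as
    the convention that [E'] is populated only for [1 <= e]. *)
Definition sign_data : {set cgraph m * {set 'I_m} * bool} :=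
  [set x | [&& connected x.1.1, bipartite x.1.1, colorless x.1.1,
      edges x.1.1 != set0, x.1.2 != set0 & #|edges x.1.1| + #|x.1.2| == s]].

Definition sign_graph x : cgraph m :=
  recolor x.1.1 (signed_coloring (some_bipartition x.1.1) x.1.2 x.2).

(** Erasing the colors recovers the graph and hence its chosen bipartition, the colored vertices
    recover [T], and the color of a single vertex of [T] recovers the sign. *)
Lemma sign_graph_inj : {in sign_data &, injective sign_graph}.
Proof.
move=> [[G T] b] [[G' T'] b']; rewrite !inE /=.
case/and5P=> _ _ /colorless_data G0 _ /andP[T0 _].
case/and5P=> _ _ /colorless_data G0' _ _ E.
have GG' : G = G'.
  by apply: cgraph_ext; [exact: (congr1 (@edges m) E) | rewrite G0 G0'].
subst G'.
have TT' : T = T'.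
  apply/setP => v.
  have := congr1 (fun H : cgraph m => colored H v) E.
  by rewrite !colored_signed.
subst T'; have [v vT] := set0Pn _ T0.
have := congr1 (fun H : cgraph m => (cgraph_data H).2 v) E.
by rewrite /= !ffunE vT => /sign_color_inj/addIb ->.
Qed.

Lemma E'''_sign_graph (v : 'I_m) : E''' R m m s = sign_graph @: sign_data.
Proof.
apply/setP => G; apply/idP/imsetP => [|[[[H T] b] + ->]]; last first.
  rewrite !inE /= => /and5P[Hc Hb H0 HE /andP[/set0Pn[w wT] /eqP HT]].
  have HA := some_bipartitionP Hb.
  have Gc : connected (sign_graph (H, T, b)) by [].
  have cw : colored (sign_graph (H, T, b)) w by rewrite colored_signed.
  rewrite Gc (connected_third_kind v Gc) HE /= andbT.
  rewrite (rank_colored R Gc (HA : bipartition (sign_graph (H, T, b)) _) cw) eqxx /=.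
  rewrite /cardinality (_ : [set u | colored _ u] = T) ?HT ?eqxx ?andbT; last first.
    by apply/setP => u; rewrite inE colored_signed.
  apply/andP; split; first by apply/asboolP/signed_central.
  by apply/existsP; exists w.
rewrite inE => /and5P[Gc /asboolP Gz + _ /eqP Gs].
rewrite (connected_third_kind v Gc) => /andP[/existsP[w cw] GE].
have Gb := central_bipartite Gc Gz cw.
(* The bipartition is chosen on [decolor G], since [sign_graph] makes its choice there; being a
   bipartition depends on the edges alone, so it serves [G] as well. *)
have HA : bipartition (decolor G) (some_bipartition (decolor G)).
  exact: some_bipartitionP.
have [b Gcol] := central_signed Gc Gz HA cw.
exists (decolor G, [set u | colored G u], b); last exact: cgraph_ext.
rewrite inE /= colorless_decolor; apply/and5P; split=> //.
rewrite -Gs /cardinality eqxx andbT /=.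
by apply/set0Pn; exists w; rewrite inE.
Qed.

Lemma card_sign_data (v : 'I_m) : #|sign_data| =
  \sum_(1 <= t < s.+1) 2 * #|E' R m (m - 1) (s - t)| * 'C(m, t).
Proof.
rewrite -sum1_card big_geq_mkord /=.
(* The triples are sorted by the size of [T], which is at most [s], so [inord] never falls back to
   its default. Each fibre is a product of a set [E'], the [t]-subsets and the two signs. *)
rewrite (partition_big (fun x => inord #|x.1.2| : 'I_s.+1) (leq 1)) /=; last first.
  move=> x; rewrite inE => /and5P[_ _ _ _ /andP[x0 /eqP xs]].
  by rewrite inordK ?card_gt0 // ltnS -xs leq_addl.
apply: eq_bigr => t t0; rewrite sum1_card -mulnA mulnC -[in 'C(m, t)](card_ord m).
rewrite -card_draws -card_bool -[#|{: bool}|]cardsT -!cardsX.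
apply: eq_card => -[[G T] b]; rewrite !in_setX /= (in_E' v) !inE /= andbT.
rewrite [LHS]/in_mem /= !inE /=.
have [Tt|Tt] := eqVneq #|T| t; last first.
  rewrite andbF; apply/negbTE/negP => /andP[/and5P[_ _ _ _ /andP[_ /eqP Gs]]].
  move=> /eqP/(congr1 val); rewrite /= inordK ?ltnS -?Gs ?leq_addl // => /eqP.
  by rewrite (negPf Tt).
rewrite Tt -card_gt0 -[T != _]card_gt0 Tt t0 inord_val eqxx !andbT /=.
have ts : t <= s by rewrite -ltnS.
(* As [t <= s], the subtraction is exact, and having [s - t] edges means having total cardinality
   [s]. *)
rewrite -(eqn_add2r t _ (s - t)) subnK //.
have [Gs|] := eqVneq (#|edges G| + t) s; last by rewrite !andbF.
have -> : s - t = #|edges G| by rewrite -[X in X - _]Gs addnK.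
by rewrite andbT -[RHS]andbC !andbA andbT.
Qed.

End Counting.

Theorem theorem4 (R : realType) (k s : nat) (hk : 1 <= k) (hs : 1 <= s) :
  #|E''' R k k s| =
  \sum_(1 <= t < s.+2 - k) 2 * #|E' R k (k - 1) (s - t)| * 'C(k, t).
Proof.
have v : 'I_k by exact: Ordinal hk.
rewrite (E'''_sign_graph R s v) (card_in_imset (@sign_graph_inj _ _)).
rewrite (card_sign_data R s v) (@big_nat_widen _ _ _ 1 (s.+2 - k) s.+1); last first.
  by rewrite leq_subLR; exact: leq_add hk (leqnn s.+1).
rewrite [RHS]big_mkcond; apply: eq_big_nat => t /andP[t1 ts] /=.
(* For [t] from [s.+2 - k] up to [s], fewer than [k - 1] edges remain, so the extra terms vanish.
   This includes the case where the stated range is empty. *)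
case: ltnP => // kt; rewrite (E'_eq0 R v) ?cards0 ?muln0 //.
by rewrite ltn_subRL add1n -subSn // ltn_subLR ?(ltnW ts) // addnC -leq_subLR.
Qed.
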